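(* Consider the weighted hook walk for a partition $\lambda$ with positive weights $(x_i)_{i\in\mathbb{Z}},(y_j)_{j\in\mathbb{Z}}$ having finite sums. For a corner $c=(r,s)$ of $\lambda$ and a region $R$, let $P(c\mid R)$ be the probability that the walk terminates in $c$ conditional on its starting square lying in $R$, and let $P(c)$ be the (unconditional) probability that it terminates in $c$. Put \[ \Pi_{rs} = x_r y_s \prod_{i = 1}^{r-1} \left(1+ \frac{x_i}{x_{i+1}+\cdots + x_{r} + y_{s+1} + \cdots + y_{\lambda_i}}\right) \cdot \prod_{j = 1}^{s-1} \left(1+ \frac{y_j}{x_{r+1}+\cdots + x_{\lambda'_j} + y_{j+1} + \cdots + y_{s}}\right). \] Then (a) $P(c\mid R_1) = \dfrac{\Pi_{rs}}{\sum_{(p,q) \in [\lambda]} x_p y_q}$; (b) $P(c\mid R_2) = \dfrac{\Pi_{rs}}{\left(\sum_{p=1}^{\ell(\lambda)} x_p\right)(x_{r+1}+\cdots+x_{\ell(\lambda)}+y_1+ \cdots + y_s)}$; (c) $P(c\mid R_3) = \dfrac{\Pi_{rs}}{\left(\sum_{q=1}^{\lambda_1} y_q\right)(x_{1}+\cdots+x_{r}+y_{s+1}+ \cdots + y_{\lambda_1})}$; (d) $P(c\mid R_4) = \dfrac{\Pi_{rs}}{(x_{r+1}+\cdots+x_{\ell(\lambda)}+y_1+ \cdots + y_s)(x_{1}+\cdots+x_{r}+y_{s+1}+ \cdots + y_{\lambda_1})}$. In particular, for each of (a)–(d), the sum of the given expression over all corners $(r,s)$ of $\lambda$ equals $1$.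 Moreover, (e) $P(c) = \dfrac{1}{\left( \sum_{p\in\mathbb{Z}} x_p\right)\left( \sum_{q\in\mathbb{Z}} y_q\right)}\left(1 + \dfrac{\sum_{p \leq 0} x_p}{x_{1}+\cdots+x_{r}+y_{s+1}+ \cdots + y_{\lambda_1}} \right)\left(1 + \dfrac{\sum_{q \leq 0} y_q}{x_{r+1}+\cdots+x_{\ell(\lambda)}+y_1+ \cdots + y_s} \right)\Pi_{rs}$.
   Context: Let $\lambda=(\lambda_1\ge\cdots\ge\lambda_\ell>0)$ be a partition, $\ell=\ell(\lambda)$, with diagram $[\lambda]=\{(i,j)\in\mathbb{Z}^2:1\le i\le\ell,1\le j\le\lambda_i\}$ ($i$ = row, increasing downward; $j$ = column) and conjugate $\lambda'_j=\max\{i:\lambda_i\ge j\}$. Extend: $\lambda_i=\lambda_1$ for $i\le 0$, $\lambda_i=0$ for $i\ge\ell+1$, $\lambda'_j=\ell$ for $j\le 0$, $\lambda'_j=0$ for $j\ge\lambda_1+1$. A corner of $\lambda$ is $(i,j)\in[\lambda]$ with $(i+1,j),(i,j+1)\notin[\lambda]$; an outer corner is $(i,j)\notin[\lambda]$, $i,j\ge1$, with ($i=1$ or $(i-1,j)\in[\lambda]$) and ($j=1$ or $(i,j-1)\in[\lambda]$). Sums $x_a+\cdots+x_b$ with $b<a$ are $0$. Regions of $\mathbb{Z}^2$: $R_1=[\lambda]$; $R_2=\{1\le i\le\ell,\ j\le0\}$; $R_3=\{i\le0,\ 1\le j\le\lambda_1\}$; $R_4=\{i\le0,\ j\le0\}$;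 $R_5=\{1\le i\le\ell,\ 1\le j\le\lambda_1,\ (i,j)\notin[\lambda]\}$; $R_6=\{1\le i\le\ell,\ j\ge\lambda_1+1\}$; $R_7=\{i\ge\ell+1,\ 1\le j\le\lambda_1\}$; $R_8=\{i\ge\ell+1,\ j\ge\lambda_1+1\}$; $R_9=\{i\ge\ell+1,\ j\le0\}$; $R_{10}=\{i\le0,\ j\ge\lambda_1+1\}$. Weighted hook walk: fix positive reals $x_i,y_j$ ($i,j\in\mathbb{Z}$) with $\sum_i x_i<\infty$, $\sum_j y_j<\infty$. The starting square $(i,j)\in\mathbb{Z}^2$ is chosen with probability $x_iy_j/((\sum_p x_p)(\sum_q y_q))$. If the current square $(i,j)$ lies in $D=R_1\cup R_2\cup R_3\cup R_4=\{(i,j): i\le \ell,\ j\le\lambda_i\}$, the walk moves to $(i',j)$ with $i<i'\le\lambda'_j$ with probability proportional to $x_{i'}$, or to $(i,j')$ with $j<j'\le\lambda_i$ with probability proportional to $y_{j'}$ (normalizing constant $x_{i+1}+\cdots+x_{\lambda'_j}+y_{j+1}+\cdots+y_{\lambda_i}$); it stops when no move is possible, i.e. at a corner of $\lambda$. If the current square lies in $D'=R_5\cup\cdots\cup R_8=\{(i,j): i\ge1,\ j\ge1,\ j>\lambda_i\}$, it moves to $(i',j)$ with $\lambda'_j<i'<i$ with probability proportional to $x_{i'}$, or to $(i,j')$ with $\lambda_i<j'<j$ with probability proportional to $y_{j'}$; it stops when no move is possible, i.e. at an outer corner of $\lambda$. Walks starting in $R_9$ (moving right or up) stop at $(\ell+1,0)$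 and walks starting in $R_{10}$ (moving left or down) stop at $(0,\lambda_1+1)$; these are neither corners nor outer corners. *)

(* Defs.v *)
From HB Require Import structures.
From mathcomp Require Import all_boot all_order all_algebra.
From mathcomp Require Import all_classical all_reals all_analysis.
Set Implicit Arguments.
Unset Strict Implicit.
Unset Printing Implicit Defensive.
Import Order.TTheory GRing.Theory Num.Theory.
Local Open Scope classical_set_scope.
Local Open Scope ring_scope.

(* A partition is the list [:: lambda_1; ...; lambda_l], so that
   l = size lam. *)
Definition is_partition (lam : seq nat) : bool :=
  sorted geq lam && (0%N \notin lam).

(* lambda_i for i in Z; nth returns 0 for i >= l + 1. *)
Definition part (lam : seq nat) (i : int) : nat :=
  if i <= 0 then head 0%N lam else nth 0%N lam (`|i|%N).-1.

(* lambda'_j = max {i in 1..l : lambda_i >= j} for j in Z. The same formula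
   gives the extension: for j <= 0 every row qualifies and the value is l; for
   j >= lambda_1 + 1 no row does and the value is 0. *)
Definition cpart (lam : seq nat) (j : int) : nat :=
  \max_(i < size lam | j <= (part lam i.+1)%:Z) i.+1.

(* Squares are pairs (row, column). *)
Definition square : Type := (int * int)%type.

Definition diagram (lam : seq nat) (s : square) : bool :=
  (1 <= s.1 <= (size lam)%:Z) && (1 <= s.2 <= (part lam s.1)%:Z).

Definition corner (lam : seq nat) (s : square) : bool :=
  [&& diagram lam s, ~~ diagram lam (s.1 + 1, s.2)
    & ~~ diagram lam (s.1, s.2 + 1)].

Definition region1 (lam : seq nat) : set square := [set s | diagram lam s].
Definition region2 (lam : seq nat) : set square :=
  [set s : square | (1 <= s.1 <= (size lam)%:Z) && (s.2 <= 0)].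
Definition region3 (lam : seq nat) : set square :=
  [set s : square | (s.1 <= 0) && (1 <= s.2 <= (part lam 1)%:Z)].
Definition region4 : set square :=
  [set s : square | (s.1 <= 0) && (s.2 <= 0)].

(* D, the union of the regions R_1, ..., R_4 *)
Definition inD (lam : seq nat) (s : square) : bool :=
  (s.1 <= (size lam)%:Z) && (s.2 <= (part lam s.1)%:Z).
Definition inR9 (lam : seq nat) (s : square) : bool :=
  ((size lam)%:Z + 1 <= s.1) && (s.2 <= 0).
Definition inR10 (lam : seq nat) (s : square) : bool :=
  (s.1 <= 0) && ((part lam 1)%:Z + 1 <= s.2).

(* Moves are down/right in D, up/left in D' (the squares outside D, R_9 and
   R_10), up/right in R_9 and down/left in R_10. The bounds also make walks
   from R_9 and R_10 stop at (l + 1, 0) and (0, lambda_1 + 1), since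
   lambda_i = 0 and lambda'_j = l in R_9, and lambda_i = lambda_1 and
   lambda'_j = 0 in R_10. *)
Definition vmove (lam : seq nat) (s : square) (i : int) : bool :=
  if inD lam s || inR10 lam s then s.1 < i <= (cpart lam s.2)%:Z
  else (cpart lam s.2)%:Z < i < s.1.

Definition hmove (lam : seq nat) (s : square) (j : int) : bool :=
  if inD lam s || inR9 lam s then s.2 < j <= (part lam s.1)%:Z
  else (part lam s.1)%:Z < j < s.2.

Definition stopped (lam : seq nat) (s : square) : Prop :=
  forall k : int, ~~ vmove lam s k /\ ~~ hmove lam s k.

Section HookWalk.
Variables (R : realType) (lam : seq nat) (x y : int -> R).

Definition move_total (s : square) : R :=
  \sum_(i \in [set i | vmove lam s i]) x i +
  \sum_(j \in [set j | hmove lam s j]) y j.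

(* Transition probability from s to t; a stopped walk stays put. *)
Definition step (s t : square) : R :=
  if `[< stopped lam s >] then (t == s)%:R
  else if (t.2 == s.2) && vmove lam s t.1 then x t.1 / move_total s
  else if (t.1 == s.1) && hmove lam s t.2 then y t.2 / move_total s
  else 0.

Definition zsum (z : int -> R) (A : set int) : R :=
  fine (\esum_(i in A) (z i)%:E).

Definition start (s : square) : R :=
  x s.1 * y s.2 / (zsum x [set: int] * zsum y [set: int]).

(* The weighted hook walk: a Markov chain S_0, S_1, ... on Z^2 with initial
   law start and transition probabilities step. *)
Definition is_hook_walk (d : measure_display) (T : measurableType d)
    (P : probability T R) (S : nat -> T -> square) : Prop :=
  [/\ forall n s, measurable (S n @^-1` [set s]),
      forall s, P (S 0%N @^-1` [set s]) = (start s)%:E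
    & forall n (s : nat -> square),
        P [set w | forall k, (k <= n.+1)%N -> S k w = s k] =
        (P [set w | forall k, (k <= n)%N -> S k w = s k] *
         (step (s n) (s n.+1))%:E)%E].

Definition terminates_in (T : Type) (S : nat -> T -> square) (c : square) :
    set T :=
  [set w | stopped lam c /\ exists n, S n w = c].

(* The product Pi_{rs}; the ranges m.+1 <= k < n.+1 are m + 1, ..., n. *)
Definition hook_Pi (r s : nat) : R :=
  x r * y s *
  (\prod_(1 <= i < r)
     (1 + x i / (\sum_(i.+1 <= p < r.+1) x p +
                 \sum_(s.+1 <= q < (part lam i).+1) y q))) *
  (\prod_(1 <= j < s)
     (1 + y j / (\sum_(r.+1 <= p < (cpart lam j).+1) x p +
                 \sum_(j.+1 <= q < s.+1) y q))).

Definition hook_low (r s : nat) : R :=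
  \sum_(r.+1 <= p < (size lam).+1) x p + \sum_(1 <= q < s.+1) y q.

Definition hook_high (r s : nat) : R :=
  \sum_(1 <= p < r.+1) x p + \sum_(s.+1 <= q < (part lam 1).+1) y q.

Definition formula1 (r s : nat) : R :=
  hook_Pi r s /
  \sum_(1 <= p < (size lam).+1) \sum_(1 <= q < (part lam p).+1) x p * y q.
Definition formula2 (r s : nat) : R :=
  hook_Pi r s / ((\sum_(1 <= p < (size lam).+1) x p) * hook_low r s).
Definition formula3 (r s : nat) : R :=
  hook_Pi r s / ((\sum_(1 <= q < (part lam 1).+1) y q) * hook_high r s).
Definition formula4 (r s : nat) : R :=
  hook_Pi r s / (hook_low r s * hook_high r s).

Definition corner_sum (F : nat -> nat -> R) : R :=
  \sum_(1 <= r < (size lam).+1)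
    \sum_(1 <= s < (part lam 1).+1 | corner lam (r%:Z, s%:Z)) F r s.

End HookWalk.

Definition cond_prob (R : realType) (d : measure_display)
    (T : measurableType d) (P : probability T R) (A B : set T) : R :=
  fine (P (A `&` B)) / fine (P B).

(* Main.v *)
Require Import Defs.
From mathcomp Require Import all_boot all_order all_algebra.
From mathcomp Require Import all_classical all_reals all_analysis.
From mathcomp Require Import zify ring.
Set Implicit Arguments.
Unset Strict Implicit.
Unset Printing Implicit Defensive.
Import Order.TTheory GRing.Theory Num.Theory.
Local Open Scope classical_set_scope.
Local Open Scope ring_scope.

(* For a corner c = (r, s), the hook at (i, j) with i <= r, j <= s has weight
   A_i + B_j, where A_i and B_j are the weights of the hooks at (i, s) and
   (r, j).  Hence the one-step recursion for the probability h(i, j) of reaching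
   c from (i, j) is solved by a product f(i) g(j), where
   A_i f(i) = sum_{i < i' <= r} x_{i'} f(i') and f(r) = 1, and similarly for g;
   h vanishes outside this quadrant, which the walk cannot enter.  The sums
   F_i = sum_{i <= i' <= r} x_{i'} f(i') satisfy F_i = F_{i+1} (1 + x_i/A_i),
   which gives Pi_{rs} = F_1 G_1, and f is constant, equal to F_1 / A_0, on
   i <= 0 because A_{i-1} = A_i + x_i there.  The sums over corners equal 1
   because the sum of h over all corners solves the same recursion as the
   constant 1. *)

(** * Sums over integer intervals and the factors f and g *)

Lemma finite_int_itv (a b : int) : finite_set [set i : int | a < i <= b].
Proof.
apply: (@sub_finite_set _ _ ((fun k : nat => a + k%:Z) @` `I_(`|b - a|.+1))).
  move=> i /= /andP[ai ib]; exists `|i - a|%N => /=; lia.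
exact/finite_image/finite_II.
Qed.

Section IntSum.
Variables (R : realType) (z : int -> R).

(** The half-open convention is that of [vmove] and [hmove] inside D, and such intervals concatenate
    without an off-by-one. *)
Definition isum (a b : int) : R := \sum_(i \in [set i | a < i <= b]) z i.

Lemma isum_geq (a b : int) : b <= a -> isum a b = 0.
Proof.
move=> ba; rewrite /isum (_ : [set i | _] = set0) ?fsbig_set0//.
by apply/seteqP; split => i //=; lia.
Qed.

Lemma isum_cat (b a c : int) : a <= b -> b <= c ->
  isum a c = isum a b + isum b c.
Proof.
move=> ab bc; rewrite /isum.
rewrite (_ : [set i | a < i <= c] =
  [set i | a < i <= b] `|` [set i | b < i <= c]); last first.
  by apply/seteqP; split => i /=; [case: (leP i b)|]; lia.
rewrite fsbigU//; try exact: finite_int_itv.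
by move=> i /= []; lia.
Qed.

Lemma isum1 (a : int) : isum (a - 1) a = z a.
Proof.
rewrite /isum (_ : [set i | _] = [set a]) ?fsbig_set1//.
by apply/seteqP; split => i /=; lia.
Qed.

Lemma isum_recl (a b : int) : a < b -> isum a b = z (a + 1) + isum (a + 1) b.
Proof.
move=> ab; rewrite (@isum_cat (a + 1)); [|lia|lia].
by have := isum1 (a + 1); rewrite addrK => ->.
Qed.

Lemma isum_nat (m n : nat) : \sum_(m.+1 <= i < n.+1) z i%:Z = isum m n.
Proof.
elim: n => [|n IH]; first by rewrite big_geq// isum_geq//; lia.
case: (leqP m n) => [mn|nm]; last by rewrite big_geq// isum_geq//; lia.
rewrite big_nat_recr//= IH (@isum_cat n m n.+1); [|lia|lia].
by rewrite -(isum1 n.+1) (_ : n.+1%:Z - 1 = n)//; lia.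
Qed.

Lemma isum_ge0 (a b : int) : (forall i, 0 < z i) -> 0 <= isum a b.
Proof. by move=> z0; apply: fsumr_ge0 => i _; rewrite ltW. Qed.

Lemma isum_gt0 (a b : int) : (forall i, 0 < z i) -> a < b -> 0 < isum a b.
Proof.
by move=> z0 ab; rewrite isum_recl// ltr_wpDr ?isum_ge0.
Qed.

End IntSum.

Lemma isum_mulr (R : realType) (z : int -> R) (c : R) (a b : int) :
  isum (fun i => z i * c) a b = isum z a b * c.
Proof. by rewrite /isum mulr_fsuml. Qed.

Lemma eq_isum (R : realType) (z w : int -> R) (a b : int) :
  (forall i, a < i <= b -> z i = w i) -> isum z a b = isum w a b.
Proof. by move=> zw; apply: eq_fsbigr => i /set_mem /zw. Qed.

Lemma isum_mull (R : realType) (z : int -> R) (c : R) (a b : int) :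
  isum (fun i => c * z i) a b = c * isum z a b.
Proof. by rewrite mulrC -isum_mulr; apply: eq_isum => i _; rewrite mulrC. Qed.

Lemma isum_eq0 (R : realType) (z : int -> R) (a b : int) :
  (forall i, a < i <= b -> z i = 0) -> isum z a b = 0.
Proof. by move=> z0; apply: fsbig1 => i; exact: z0. Qed.

(** * The factor of h in one direction, for general weights and tails *)

Section Factor.
Variables (R : realType) (z tail : int -> R) (r : int).
Hypothesis z_gt0 : forall i, 0 < z i.
Hypothesis tail_ge0 : forall i, 0 <= tail i.
Hypothesis tail_r : tail r = 0.

(** For rows, [z] is [x] and [tail i] is y_{s+1} + ... + y_{λ_i}, so this is the hook weight A_i at
    (i, s). Columns use it with the roles exchanged, which gives B_j. *)
Definition arm (i : int) : R := isum z i r + tail i.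

(* In the notation of the header, [hook_factor_sum k] is F_(r-k) and
   [hook_factor] is f, extended by 0 beyond r. *)
Fixpoint hook_factor_sum (k : nat) : R :=
  if k is k'.+1 then
    hook_factor_sum k' * (1 + z (r - k%:Z) / arm (r - k%:Z))
  else z r.

Definition hook_factor (i : int) : R :=
  if r < i then 0 else
  if `|r - i|%N is k.+1 then hook_factor_sum k / arm i else 1.

Lemma arm_gt0 (i : int) : i < r -> 0 < arm i.
Proof. by move=> ir; rewrite ltr_wpDr// isum_gt0. Qed.

Lemma hook_factor_gt (i : int) : r < i -> hook_factor i = 0.
Proof. by rewrite /hook_factor => ->. Qed.

Lemma hook_factor_r : hook_factor r = 1.
Proof. by rewrite /hook_factor ltxx subrr. Qed.

Lemma hook_factor_lt (k : nat) :
  hook_factor (r - k.+1%:Z) = hook_factor_sum k / arm (r - k.+1%:Z).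
Proof.
rewrite /hook_factor ifF; last lia.
by rewrite (_ : `|r - _|%N = k.+1)//; lia.
Qed.

(** By F_i = F_{i+1} + z_i f(i) and f(i) = F_{i+1} / A_i. The interval is open on the left, so its
    first index is r - k. *)
Lemma isum_factor (k : nat) :
  isum (fun i => z i * hook_factor i) (r - k.+1%:Z) r = hook_factor_sum k.
Proof.
elim: k => [|k IH].
  by rewrite isum1 hook_factor_r mulr1.
rewrite isum_recl; last lia.
have -> : r - k.+2%:Z + 1 = r - k.+1%:Z by lia.
by rewrite IH hook_factor_lt /=; ring.
Qed.

Lemma hook_factor_rec (i : int) : i <= r ->
  arm i * hook_factor i = isum (fun i => z i * hook_factor i) i r.
Proof.
move=> ir; have [->|[k ->]] : i = r \/ exists k : nat, i = r - k.+1%:Z.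
    case: (eqVneq i r) => [|ne]; [by left|right].
    by exists (`|r - i|%N.-1); lia.
  (* At i = r both sides vanish: the sums are empty and the tail is 0. *)
  by rewrite /arm isum_geq// [RHS]isum_geq// tail_r add0r mul0r.
rewrite isum_factor hook_factor_lt mulrC divfK// gt_eqF// arm_gt0//; lia.
Qed.

(** Since f vanishes beyond r, the range may run to the end of a whole row or column, as it does in
    the walk. *)
Lemma isum_factor_cap (a b : int) : r <= b ->
  isum (fun i => z i * hook_factor i) a b =
  isum (fun i => z i * hook_factor i) a r.
Proof.
move=> rb; have zero (c : int) : r <= c ->
    isum (fun i => z i * hook_factor i) c b = 0.
  by move=> rc; apply: isum_eq0 => i ?; rewrite hook_factor_gt ?mulr0//; lia.
case: (leP r a) => [ra|ar]; first by rewrite zero// isum_geq.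
by rewrite (@isum_cat _ _ r)// ?zero ?addr0// ltW.
Qed.

Lemma hook_factor_sum_gt0 (k : nat) : 0 < hook_factor_sum k.
Proof.
elim: k => //= k IH; rewrite mulr_gt0// ltr_wpDr//.
by rewrite divr_ge0 ?ltW// arm_gt0//; lia.
Qed.

Lemma hook_factor_ge0 (i : int) : 0 <= hook_factor i.
Proof.
case: (ltP r i) => [?|ir]; first by rewrite hook_factor_gt.
have [->|[k ->]] : i = r \/ exists k : nat, i = r - k.+1%:Z.
    case: (eqVneq i r) => [|ne]; [by left|right].
    by exists (`|r - i|%N.-1); lia.
  by rewrite hook_factor_r.
rewrite hook_factor_lt divr_ge0// ltW// ?hook_factor_sum_gt0// arm_gt0//; lia.
Qed.

Lemma hook_factor_le0 (i : int) :
  1 <= r -> (forall i, i <= 0 -> tail i = tail 0) -> i <= 0 ->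
  hook_factor i = isum (fun i => z i * hook_factor i) 0 r / arm 0.
Proof.
move=> r1 tail0 i0.
have -> : i = - `|i|%N%:Z by lia.
elim: `|i|%N => [|n IH].
  have A0 : 0 < arm 0 by apply: arm_gt0; lia.
  have <- := @hook_factor_rec 0; last lia.
  by rewrite oppr0 mulrAC divff ?mul1r// gt_eqF.
rewrite -IH.
have A1 : 0 < arm (- n.+1%:Z) by apply: arm_gt0; lia.
(* After multiplying by A_{-(n+1)}, the recursion at -(n+1) and at -n reduces the claim to
   A_{-(n+1)} = z_{-n} + A_{-n}. *)
apply: (mulfI (lt0r_neq0 A1)).
rewrite hook_factor_rec; last lia.
rewrite isum_recl; last lia.
have e : - n.+1%:Z + 1 = - n%:Z by lia.
rewrite e -hook_factor_rec; last lia.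
rewrite -mulrDl; congr (_ * _).
rewrite /arm [in RHS]isum_recl; last lia.
by rewrite e (tail0 (- n.+1%:Z)) ?(tail0 (- n%:Z)); [ring|lia|lia].
Qed.

End Factor.

Lemma isum_factor_prod (R : realType) (z tail : int -> R) (r : nat) :
  (1 <= r)%N ->
  isum (fun i => z i * hook_factor z tail r i) 0 r =
  z r * \prod_(1 <= i < r) (1 + z i / arm z tail r i).
Proof.
move=> r1; have -> : (0 : int) = r%:Z - r.-1.+1%:Z by lia.
rewrite isum_factor.
(* [hook_factor_sum] multiplies downwards from r - 1, so the product is reversed. *)
have -> : \prod_(1 <= i < r) (1 + z i / arm z tail r i) =
   \prod_(0 <= k < r.-1)
     (1 + z (r%:Z - k.+1%:Z) / arm z tail r (r%:Z - k.+1%:Z)).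
  rewrite big_add1 big_nat_rev/= !big_nat; apply: eq_bigr => k kr.
  by rewrite (_ : (0 + r.-1 - k.+1).+1%:Z = r%:Z - k.+1%:Z)//; lia.
elim: r.-1 => [|k IH]; first by rewrite big_geq// mulr1.
by rewrite big_nat_recr//= IH mulrA.
Qed.

(** * Shape of the extended diagram *)

Section Shape.
Variable lam : seq nat.
Hypothesis lam_part : is_partition lam.
Local Notation l := (size lam).

Lemma part_le0 (i : int) : i <= 0 -> part lam i = part lam 0.
Proof. by rewrite /part => ->. Qed.

Lemma part0 : part lam 0 = part lam 1.
Proof. by rewrite /part /= nth0. Qed.

Lemma leq_part (i j : int) : i <= j -> (part lam j <= part lam i)%N.
Proof.
have nat_case (m n : nat) : (m <= n)%N -> (nth 0 lam n <= nth 0 lam m)%N.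
  move=> mn; case: (ltnP n l) => nl; last by rewrite nth_default.
  have /andP[srt _] := lam_part.
  have geq_tr : transitive geq by move=> a b c ab bc; exact: leq_trans bc ab.
  exact: (sorted_leq_nth geq_tr leqnn 0%N srt) (leq_ltn_trans mn nl) nl mn.
move=> ij; rewrite /part; case: (leP i 0) => i0; case: (leP j 0) => j0.
- by [].
- by rewrite -nth0 nat_case.
- lia.
- by apply: nat_case; lia.
Qed.

Lemma part_row_gt0 (i : int) : lam <> [::] -> i <= l%:Z -> (0 < part lam i)%N.
Proof.
move=> lam0 il; have /andP[_ n0] := lam_part.
have l0 : (0 < l)%N by case: (lam) lam0.
have gt0 k : (k < l)%N -> (0 < nth 0%N lam k)%N.
  move=> kl; rewrite lt0n; apply: contra n0 => /eqP <-; exact: mem_nth.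
rewrite /part; case: (leP i 0) => i0; first by rewrite -nth0 gt0.
by apply: gt0; lia.
Qed.

Lemma cpart_leq (j : int) : (cpart lam j <= l)%N.
Proof. by apply/bigmax_leqP => i _; exact: ltn_ord. Qed.

(** Row and column lengths describe the same diagram; the later facts about [cpart] in this part
    follow from this by linear arithmetic. For i <= 0 and j > λ_1 the left side would hold and the
    right side fail. *)
Lemma le_cpart (i j : int) : 1 <= i ->
  (i <= (cpart lam j)%:Z) = (i <= l%:Z) && (j <= (part lam i)%:Z).
Proof.
move=> i1; apply/idP/idP => [|/andP[il ji]].
  (* If the right side fails, every row counted by the maximum lies above row i, either since i > l
     or since row lengths decrease. *)
  apply: contraTT => nij; suff : (cpart lam j <= `|i|.-1)%N by lia.
  apply/bigmax_leqP => k jk.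
  by have := ltn_ord k; have := @leq_part i k.+1; lia.
have kl : (`|i|.-1 < l)%N by lia.
have := @leq_bigmax_cond _ (fun k : 'I_l => j <= (part lam k.+1)%:Z)
   (fun k => k.+1) (Ordinal kl).
rewrite /= -/(cpart lam j) (_ : `|i|.-1.+1%:Z = i); last lia.
by move=> /(_ ji); lia.
Qed.

Lemma leq_cpart (i j : int) : i <= j -> (cpart lam j <= cpart lam i)%N.
Proof.
move=> ij; case: (posnP (cpart lam j)) => [->//|c0].
have := @le_cpart (cpart lam j) j; have := @le_cpart (cpart lam j) i; lia.
Qed.

Lemma cpart_le0 (j : int) : lam <> [::] -> j <= 0 -> cpart lam j = l.
Proof.
move=> lam0 j0; have l0 : (0 < l)%N by case: (lam) lam0.
have := @le_cpart l j; have := cpart_leq j; lia.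
Qed.

Lemma cornerP (r s : nat) : corner lam (r%:Z, s%:Z) ->
  [/\ (1 <= r <= l)%N, (1 <= s)%N, part lam r = s & cpart lam s = r].
Proof.
rewrite /corner /diagram /= => /and3P[].
have := @le_cpart r s; have := @le_cpart (r%:Z + 1) s.
have := @leq_part r (r%:Z + 1); have := cpart_leq s.
move=> *; split; lia.
Qed.

(** In rows or columns <= 0 of D a move always exists, because λ_1 and l are positive; inside the
    diagram, having no move is being a corner. *)
Lemma corner_of_no_move (i j : int) : lam <> [::] ->
  inD lam (i, j) -> (cpart lam j)%:Z <= i -> (part lam i)%:Z <= j ->
  corner lam (i, j).
Proof.
rewrite /inD /corner /diagram /= => lam0 /andP[il jp] ci pj.
have l0 : (0 < l)%N by case: (lam) lam0.
have := @part_row_gt0 i lam0 il.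
have := @le_cpart 1 j; have := @le_cpart i j; have := @le_cpart (i + 1) j.
have := @leq_part i 1; have := @part_le0 i; have := part0.
case: (leP i 0) => i0; lia.
Qed.

Lemma inD_vmove (i j k : int) : lam <> [::] ->
  inD lam (i, j) -> i < k -> k <= (cpart lam j)%:Z -> inD lam (k, j).
Proof.
rewrite /inD /= => lam0 /andP[il jp] ik kc.
have := cpart_leq j; have := @le_cpart k j.
have := @part_le0 i; have := @part_le0 k; case: (leP k 0) => k0; lia.
Qed.

End Shape.

(** * Hitting probabilities *)

Section Hit.
Variables (R : realType) (lam : seq nat) (x y : int -> R).
Hypotheses (lam_part : is_partition lam) (lam_neq0 : lam <> [::]).
Hypotheses (x_gt0 : forall i, 0 < x i) (y_gt0 : forall j, 0 < y j).

(** The part of row i beyond column s; it vanishes at i = r for a corner (r, s), where λ_r = s. *)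
Definition row_tail (s : nat) (i : int) : R := isum y s (part lam i).
Definition col_tail (r : nat) (j : int) : R := isum x r (cpart lam j).
Definition row_factor (r s : nat) : int -> R := hook_factor x (row_tail s) r.
Definition col_factor (r s : nat) : int -> R := hook_factor y (col_tail r) s.

(** The candidate f(i) g(j) for the probability of reaching (r, s); [P_terminates] shows that it is
    this probability. *)
Definition hit (r s : nat) (t : square) : R :=
  row_factor r s t.1 * col_factor r s t.2.

Lemma row_tail_ge0 (s : nat) (i : int) : 0 <= row_tail s i.
Proof. exact: isum_ge0. Qed.

Lemma col_tail_ge0 (r : nat) (j : int) : 0 <= col_tail r j.
Proof. exact: isum_ge0. Qed.

Lemma row_factor_ge0 (r s : nat) (i : int) : 0 <= row_factor r s i.
Proof. exact/hook_factor_ge0/row_tail_ge0. Qed.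

Lemma col_factor_ge0 (r s : nat) (j : int) : 0 <= col_factor r s j.
Proof. exact/hook_factor_ge0/col_tail_ge0. Qed.

Lemma hit_ge0 (r s : nat) (t : square) : 0 <= hit r s t.
Proof. by rewrite mulr_ge0 ?row_factor_ge0 ?col_factor_ge0. Qed.

Lemma hit_gt (r s : nat) (t : square) :
  ~~ ((t.1 <= r%:Z) && (t.2 <= s%:Z)) -> hit r s t = 0.
Proof.
rewrite negb_and -!ltNge /hit /row_factor /col_factor => /orP[] ?.
  by rewrite (@hook_factor_gt _ x) ?mul0r.
by rewrite (@hook_factor_gt _ y) ?mulr0.
Qed.

Lemma hit_self (r s : nat) : hit r s (r%:Z, s%:Z) = 1.
Proof. by rewrite /hit /row_factor /col_factor !hook_factor_r mulr1. Qed.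

Lemma move_totalE (i j : int) : inD lam (i, j) ->
  move_total lam x y (i, j) =
    isum x i (cpart lam j) + isum y j (part lam i).
Proof. by rewrite /move_total /vmove /hmove => -> /=. Qed.

Lemma hit_rec (r s : nat) (i j : int) : corner lam (r%:Z, s%:Z) ->
  inD lam (i, j) ->
  move_total lam x y (i, j) * hit r s (i, j) =
    isum (fun k => x k * hit r s (k, j)) i (cpart lam j) +
    isum (fun k => y k * hit r s (i, k)) j (part lam i).
Proof.
move=> c ijD; rewrite move_totalE//.
have [rl s1 pr cs] := cornerP lam_part c.
(* Outside the quadrant up to c everything vanishes, since moves in D only increase coordinates. *)
case: (boolP ((i <= r%:Z) && (j <= s%:Z))) => [/andP[ir js]|nQ]; last first.
  rewrite hit_gt// mulr0 !isum_eq0 ?addr0// => k kij;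
    rewrite hit_gt ?mulr0//=; lia.
have rcj : (r <= cpart lam j)%N by rewrite -cs leq_cpart.
have spi : (s <= part lam i)%N by rewrite -pr leq_part.
have row_r : row_tail s r = 0 by rewrite /row_tail pr isum_geq.
have col_s : col_tail r s = 0 by rewrite /col_tail cs isum_geq.
have rowE : isum (fun k => x k * hit r s (k, j)) i (cpart lam j) =
    arm x (row_tail s) r i * row_factor r s i * col_factor r s j.
  rewrite hook_factor_rec//; last exact: row_tail_ge0.
  rewrite -(@isum_factor_cap _ _ _ _ _ (cpart lam j)); last lia.
  by rewrite -isum_mulr; apply: eq_isum => k _; rewrite mulrA.
have colE : isum (fun k => y k * hit r s (i, k)) j (part lam i) =
    arm y (col_tail r) s j * col_factor r s j * row_factor r s i.
  rewrite hook_factor_rec//; last exact: col_tail_ge0.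
  rewrite -(@isum_factor_cap _ _ _ _ _ (part lam i)); last lia.
  by rewrite -isum_mulr; apply: eq_isum => k _; rewrite -mulrA [hit _ _ _]mulrC.
rewrite rowE colE /arm /row_tail /col_tail /hit /=.
(* Cutting column j at row r and row i at column s regroups the hook weight at (i, j) into A_i +
   B_j. *)
rewrite (@isum_cat _ x r i (cpart lam j)); [|lia|lia].
by rewrite (@isum_cat _ y s j (part lam i)); [ring|lia|lia].
Qed.

Lemma move_total_gt0 (i j : int) : inD lam (i, j) -> ~~ corner lam (i, j) ->
  0 < move_total lam x y (i, j).
Proof.
move=> ijD nc; rewrite move_totalE//.
case: (ltP i (cpart lam j)%:Z) => ic.
  by rewrite ltr_wpDr ?isum_ge0 ?isum_gt0.
case: (ltP j (part lam i)%:Z) => jp.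
  by rewrite ltr_wpDl ?isum_ge0 ?isum_gt0.
by case/negP: nc; apply: corner_of_no_move.
Qed.

Lemma corner_sumM (c : R) (F : nat -> nat -> R) :
  corner_sum lam (fun r s => c * F r s) = c * corner_sum lam F.
Proof.
by rewrite /corner_sum mulr_sumr; apply: eq_bigr => r _; rewrite mulr_sumr.
Qed.

Lemma corner_sumD (F G : nat -> nat -> R) :
  corner_sum lam (fun r s => F r s + G r s) =
  corner_sum lam F + corner_sum lam G.
Proof.
by rewrite /corner_sum -big_split; apply: eq_bigr => r _; rewrite big_split.
Qed.

Lemma eq_corner_sum (F G : nat -> nat -> R) :
  (forall r s, corner lam (r%:Z, s%:Z) -> F r s = G r s) ->
  corner_sum lam F = corner_sum lam G.
Proof. by move=> FG; apply: eq_bigr => r _; apply: eq_bigr => s /FG. Qed.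

Lemma corner_sum_isum (z : int -> R) (F : int -> nat -> nat -> R) (a b : int) :
  corner_sum lam (fun r s => isum (fun k => z k * F k r s) a b) =
  isum (fun k => z k * corner_sum lam (F k)) a b.
Proof.
rewrite /isum !fsbig_finite/=; try exact: finite_int_itv.
under [RHS]eq_bigr do rewrite -corner_sumM.
rewrite /corner_sum [RHS]exchange_big/=; apply: eq_bigr => r _.
rewrite [RHS]exchange_big/=; apply: eq_bigr => s _.
by rewrite fsbig_finite//=; exact: finite_int_itv.
Qed.

Lemma corner_sum_corner (r0 s0 : nat) (F : nat -> nat -> R) :
  corner lam (r0%:Z, s0%:Z) ->
  (forall r s, corner lam (r%:Z, s%:Z) -> (r, s) != (r0, s0) -> F r s = 0) ->
  corner_sum lam F = F r0 s0.
Proof.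
move=> c0 F0; have [rl s1 pr cs] := cornerP lam_part c0.
have sl : (s0 <= part lam 1)%N by rewrite -pr leq_part//; lia.
rewrite /corner_sum (bigD1_seq r0) ?iota_uniq ?mem_index_iota//=.
rewrite [X in _ + X]big1 ?addr0 => [|r nr]; last first.
  by rewrite big1// => s c; apply: F0 => //; rewrite xpair_eqE (negbTE nr).
rewrite -big_filter (bigD1_seq s0) ?filter_uniq ?iota_uniq//; last first.
  by rewrite mem_filter c0 mem_index_iota; lia.
rewrite /= big_filter_cond [X in _ + X]big1 ?addr0// => s /andP[c ns].
by apply: F0 => //; rewrite xpair_eqE (negbTE ns) andbF.
Qed.

(** Induction along the moves in D: at a corner only its own h is nonzero, and elsewhere the
    recursion can be divided by a positive hook weight. *)
Lemma corner_sum_hit (t : square) : inD lam t ->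
  corner_sum lam (fun r s => hit r s t) = 1.
Proof.
(* The distance to (l, λ_1) drops with each move in D, because λ_i <= λ_1. *)
have [n] := ubnP (`|(size lam)%:Z - t.1| + `|(part lam 1)%:Z - t.2|)%N.
elim: n t => // n IH [i j] /= ijn ijD.
have il : i <= (size lam)%:Z by case/andP: ijD.
have jp : j <= (part lam i)%:Z by case/andP: ijD.
have p1 (k : int) : (part lam k <= part lam 1)%N.
  by case: (leP k 0) => k0; [rewrite part_le0// part0|rewrite leq_part].
have [c|nc] := boolP (corner lam (i, j)).
  have [r0 er0] : exists r0 : nat, i = r0%:Z.
    by exists `|i|%N; move: c; rewrite /corner /diagram /=; lia.
  have [s0 es0] : exists s0 : nat, j = s0%:Z.
    by exists `|j|%N; move: c; rewrite /corner /diagram /=; lia.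
  subst i j; rewrite (corner_sum_corner c) ?hit_self// => r s c' ne.
  (* Two corners with r0 <= r and s0 <= s coincide: s = λ_r <= λ_{r0} = s0 and r = λ'_s <= λ'_{s0} =
     r0. *)
  apply: hit_gt => /=; apply/negP => /andP[r0r s0s].
  have [_ _ pr0 cs0] := cornerP lam_part c.
  have [_ _ pr cs] := cornerP lam_part c'.
  have := @leq_part _ lam_part r0 r; have := @leq_cpart _ lam_part s0 s.
  move: ne; rewrite xpair_eqE; lia.
have tot0 := move_total_gt0 ijD nc.
apply: (mulfI (lt0r_neq0 tot0)); rewrite -corner_sumM mulr1.
rewrite (eq_corner_sum (fun r s c => hit_rec c ijD)) corner_sumD.
rewrite !corner_sum_isum [RHS]move_totalE//; congr (_ + _).
  apply: eq_isum => k /andP[ik kc]; rewrite IH ?mulr1 ?(inD_vmove _ _ ijD)//=.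
  have := cpart_leq lam j; have := p1 i; lia.
apply: eq_isum => k /andP[jk kp]; rewrite IH ?mulr1 /inD/= ?il//.
by have := p1 i; lia.
Qed.

End Hit.

(** * Sums over countable fibers *)

(** A nonnegative constant commutes with the supremum over finite subsets and with each finite
    sum. *)
Lemma ge0_esumZl (R : realType) (I : choiceType) (D : set I) (c : R)
    (a : I -> \bar R) : 0 <= c -> (forall i, D i -> (0 <= a i)%E) ->
  (\esum_(i in D) (c%:E * a i) = c%:E * \esum_(i in D) a i)%E.
Proof.
move=> c0 a0; rewrite /esum -ereal_supZl//; last first.
  by apply/set0P; exists 0%E, set0; [exact: fsets_set0|rewrite fsbig_set0].
congr ereal_sup; rewrite image_comp; apply: eq_imagel => A [finA AD] /=.
rewrite !fsbig_finite//= big_seq [in RHS]big_seq ge0_sume_distrr// => i.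
by rewrite in_fset_set// => /set_mem /AD /a0.
Qed.

Lemma esum_support (R : realType) (I : choiceType) (D E : set I)
    (a : I -> \bar R) : E `<=` D -> (forall i, D i -> ~ E i -> a i = 0%E) ->
  (\esum_(i in D) a i = \esum_(i in E) a i)%E.
Proof.
move=> ED a0; rewrite esum_mkcond [RHS]esum_mkcond; apply: eq_esum => i _.
case: ifPn => [/set_mem Di|/negP nDi]; case: ifPn => [/set_mem Ei|/negP nEi] //.
- by apply: a0 => //; apply: contra_not nEi => /mem_set.
- by case: nDi; apply/mem_set/ED.
Qed.

Section CountableFibers.
Context d (T : measurableType d) (R : realType).
Context (mu : {measure set T -> \bar R}).
Context (I : countType) (X : T -> I).
Hypothesis mX : forall i, measurable (X @^-1` [set i]).

Lemma measurable_preimage_count (D : set I) : measurable (X @^-1` D).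
Proof.
rewrite (_ : _ @^-1` _ = \bigcup_i (X @^-1` (D `&` [set i]))); last first.
  by apply/seteqP; split => [w Dw|w [i _ [/= Di _]]] //; exists (X w).
apply: countable_bigcupT_measurable => [|i]; first exact: countableP.
have [Di|nDi] := pselect (D i).
  by rewrite (_ : D `&` _ = [set i])//; apply/seteqP; split => [j []|j ->].
rewrite (_ : D `&` _ = set0) ?preimage_set0//.
by apply/seteqP; split => j [] //= Dj ji; rewrite ji in Dj.
Qed.

(** Countable additivity over the codes [pickle i]; a natural number that codes no element of D
    contributes an empty set. *)
Lemma measure_fibers (A : set T) (D : set I) : measurable A ->
  (mu (A `&` X @^-1` D) = \esum_(i in D) mu (A `&` X @^-1` [set i]))%E.
Proof.
move=> mA.
pose F n := A `&` X @^-1` (D `&` [set i | pickle i = n]).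
have mF n : measurable (F n).
  by apply: measurableI => //; exact: measurable_preimage_count.
have -> : A `&` X @^-1` D = \bigcup_n F n.
  apply/seteqP; split => [w [Aw Dw]|w [n _ [Aw [Dw _]]]] //.
  by exists (pickle (X w)).
rewrite measure_bigcup//; last first.
  apply/trivIsetP => m n _ _ /eqP mn; apply/seteqP; split => // w.
  by case=> -[_ [_ /= wm]] [_ [_ /= wn]]; apply: mn; rewrite -wm.
rewrite nneseries_esum//.
rewrite (@esum_support _ _ _ (pickle @` D)); first last.
- move=> n _ nD; rewrite (_ : F n = set0) ?measure0//.
  by apply/seteqP; split => w //= -[_ [Dw wn]]; apply: nD; exists (X w).
- by move=> n _ /=; rewrite in_setT.
rewrite esum_image => [|i j _ _]; last exact: (pcan_inj pickleK).
apply: eq_esum => i Di; congr (mu (_ `&` _)).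
apply/seteqP; split => w /= => [[_ /(pcan_inj pickleK)]|->] //.
Qed.

End CountableFibers.

(** * Hitting a state of a Markov chain *)

Section MarkovChain.
Context d (T : measurableType d) (R : realType) (P : probability T R).
Context (I : countType) (S : nat -> T -> I) (p : I -> I -> R).

(** These are the cylinder sets of [is_hook_walk]; only the values of s up to time n matter. *)
Definition path_prefix (n : nat) (s : nat -> I) : set T :=
  [set w | forall k, (k <= n)%N -> S k w = s k].

Hypothesis mS : forall n i, measurable (S n @^-1` [set i]).
Hypothesis P_prefix : forall n s,
  P (path_prefix n.+1 s) = (P (path_prefix n s) * (p (s n) (s n.+1))%:E)%E.

(** Paths are total functions, so a one-step continuation gets a constant tail, of which
    [path_prefix] at time n + 1 sees only the first value. *)
Definition extend (n : nat) (s : nat -> I) (i : I) (k : nat) : I :=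
  if (k <= n)%N then s k else i.

(** Counting visits from time n on lets a prefix that does not end in c be extended by one step, as
    in [reachS]. *)
Definition reach (n : nat) (c : I) : set T :=
  [set w | exists k, (n <= k)%N /\ S k w = c].

Lemma prefix_extend (n : nat) (s : nat -> I) (i : I) :
  path_prefix n s `&` S n.+1 @^-1` [set i] = path_prefix n.+1 (extend n s i).
Proof.
apply/seteqP; split => [w [ws /= wi] k|w ws].
  by rewrite /extend leq_eqVlt ltnS => /orP[/eqP ->|kn];
    [rewrite ltnn|rewrite kn ws].
split => [k kn|/=]; first by rewrite ws /extend ?kn// leqW.
by rewrite ws// /extend ltnn.
Qed.

Lemma prefix_extend0 (n : nat) (s : nat -> I) (i : I) :
  path_prefix n (extend n s i) = path_prefix n s.
Proof.
by apply/seteqP; split => w ws k kn; have := ws k kn; rewrite /extend kn.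
Qed.

Lemma P_prefix_extend (n : nat) (s : nat -> I) (i : I) :
  P (path_prefix n.+1 (extend n s i)) =
  (P (path_prefix n s) * (p (s n) i)%:E)%E.
Proof. by rewrite P_prefix prefix_extend0 /extend leqnn ltnn. Qed.

Lemma measurable_prefix (n : nat) (s : nat -> I) : measurable (path_prefix n s).
Proof.
rewrite (_ : path_prefix n s = \bigcap_(k in `I_n.+1) (S k @^-1` [set s k])).
  by apply: fin_bigcap_measurable => // k _; exact: mS.
by apply/seteqP; split => w ws k kn; apply: ws.
Qed.

Lemma measurable_reach (n : nat) (c : I) : measurable (reach n c).
Proof.
rewrite (_ : reach n c =
  \bigcup_(k in [set k | (n <= k)%N]) (S k @^-1` [set c])).
  by apply: bigcup_measurable => k _; exact: mS.
by apply/seteqP; split => w [k]; [move=> [nk wk]|move=> nk wk]; exists k.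
Qed.

Lemma reachS (n : nat) (c : I) (s : nat -> I) : s n != c ->
  path_prefix n s `&` reach n c = path_prefix n s `&` reach n.+1 c.
Proof.
move=> /eqP sc.
apply/seteqP; split => w [ws [k [nk wk]]]; split => //; exists k.
  by rewrite ltn_neqAle nk andbT; split => //; apply/eqP => nk';
    apply: sc; rewrite -wk -nk' ws.
by rewrite ltnW.
Qed.

Lemma P_prefix0 (n : nat) (s : nat -> I) (A : set T) :
  measurable A -> P (path_prefix n s) = 0%E -> P (path_prefix n s `&` A) = 0%E.
Proof.
move=> mA P0; apply/eqP; rewrite -measure_le0 -P0.
by apply: le_measure; rewrite ?inE//;
  [apply: measurableI => //|]; exact: measurable_prefix.
Qed.

Lemma first_step (n : nat) (s : nat -> I) (A : set T) : measurable A ->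
  (P (path_prefix n s `&` A) =
   \esum_(i in [set: I]) P (path_prefix n.+1 (extend n s i) `&` A))%E.
Proof.
move=> mA; have := measure_fibers P (mS n.+1) [set: I]
  (measurableI _ _ (measurable_prefix n s) mA).
rewrite preimage_setT setIT => ->; apply: eq_esum => i _.
by rewrite -prefix_extend setIAC.
Qed.

Variable (c : I) (Z : set I).
Hypothesis Z_closed : forall i j, Z i -> p i j != 0 -> Z j.
Hypothesis Z_c : ~ Z c.

(** From Z the chain can leave only along null prefixes, so a visit to c at a fixed time has
    probability 0, and there are countably many times. *)
Lemma P_avoid (n : nat) (s : nat -> I) : Z (s n) ->
  P (path_prefix n s `&` reach n c) = 0%E.
Proof.
have avoid k : forall n s, Z (s n) ->
    P (path_prefix n s `&` S (n + k)%N @^-1` [set c]) = 0%E.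
  elim: k => [|k IH] {}n {}s Zs.
    rewrite (_ : _ `&` _ = set0) ?measure0//; apply/seteqP; split => w //=.
    by move=> [ws]; rewrite addn0 ws// => sc; apply: Z_c; rewrite -sc.
  rewrite first_step//; apply: esum1 => i _.
  have [p0|p0] := eqVneq (p (s n) i) 0.
    by rewrite P_prefix0// P_prefix_extend p0 mule0.
  rewrite addnS -addSn IH// /extend ltnn.
  exact: Z_closed p0.
move=> Zs; apply: measure_negligible.
  exact: measurableI (measurable_prefix _ _) (measurable_reach _ _).
apply: (@negligibleS _ _ _ P
  (\bigcup_k (path_prefix n s `&` S (n + k)%N @^-1` [set c]))).
  move=> w [ws [k [nk wk]]]; exists (k - n)%N => //; split => //=.
  by rewrite subnKC.
apply: negligible_bigcup => k; apply/negligibleP; last exact: avoid.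
by apply: measurableI => //; exact: measurable_prefix.
Qed.

Variables (h : I -> R) (rank : I -> nat).
Hypothesis p_ge0 : forall i j, 0 <= p i j.
Hypothesis h_ge0 : forall i, 0 <= h i.
Hypothesis h_Z : forall i, Z i -> h i = 0.
Hypothesis h_c : h c = 1.
Hypothesis h_harmonic : forall i, ~ Z i -> i != c ->
  (\esum_(j in [set: I]) (p i j * h j)%:E = (h i)%:E)%E.
Hypothesis rank_lt : forall i j, ~ Z i -> i != c -> p i j != 0 ->
  (rank j < rank i)%N.

(** Induction on [rank], which drops along every possible step away from c and Z: conditioning on
    one step and harmonicity suffice, with no limit argument. *)
Lemma P_reach (n : nat) (s : nat -> I) :
  P (path_prefix n s `&` reach n c) = (P (path_prefix n s) * (h (s n))%:E)%E.
Proof.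
have [m] := ubnP (rank (s n)); elim: m n s => // m IH n s sm.
have [Zs|nZs] := pselect (Z (s n)); first by rewrite P_avoid// h_Z// mule0.
have [sc|sc] := eqVneq (s n) c.
  rewrite sc h_c mule1; congr (P _); apply: setIidl => w ws.
  by exists n; rewrite ws.
rewrite reachS// first_step; last exact: measurable_reach.
have finP : P (path_prefix n s) \is a fin_num.
  exact: fin_num_measure (measurable_prefix _ _).
rewrite -h_harmonic// -(fineK finP) -ge0_esumZl ?fine_ge0//; last first.
  by move=> i _; rewrite lee_fin mulr_ge0.
apply: eq_esum => i _; rewrite (fineK finP) EFinM muleA -P_prefix_extend.
(* A transition of probability 0 need not lower the rank, but then both sides are 0. *)
have [p0|p0] := eqVneq (p (s n) i) 0.
  rewrite P_prefix_extend p0 mule0 mul0e.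
  apply: P_prefix0; first exact: measurable_reach.
  by rewrite P_prefix_extend p0 mule0.
have e : extend n s i n.+1 = i by rewrite /extend ltnn.
by rewrite IH e//; apply: leq_trans (rank_lt nZs sc p0) _.
Qed.

End MarkovChain.

(** * The hook walk *)

Section Walk.
Variables (R : realType) (lam : seq nat) (x y : int -> R).
Hypotheses (lam_part : is_partition lam) (lam_neq0 : lam <> [::]).
Hypotheses (x_gt0 : forall i, 0 < x i) (y_gt0 : forall j, 0 < y j).

Lemma step_ge0 (t u : square) : 0 <= step lam x y t u.
Proof.
have tot0 : 0 <= move_total lam x y t.
  by rewrite addr_ge0//; apply: fsumr_ge0 => i _; rewrite ltW.
rewrite /step; case: ifP => _; first exact: ler0n.
case: ifP => _; first by rewrite divr_ge0// ltW.
by case: ifP => _ //; rewrite divr_ge0// ltW.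
Qed.

Lemma step_neq0 (t u : square) : step lam x y t u != 0 ->
  [\/ stopped lam t /\ u = t, u.2 = t.2 /\ vmove lam t u.1 |
      u.1 = t.1 /\ hmove lam t u.2].
Proof.
rewrite /step; case: ifPn => [/asboolP st|_].
  by case: (eqVneq u t) => [->|_ /[!eqxx]//] _; apply: Or31.
case: ifPn => [/andP[/eqP ? ?] _|_]; first by apply: Or32.
by case: ifPn => [/andP[/eqP ? ?] _|_ /[!eqxx]//]; apply: Or33.
Qed.

Lemma not_stopped (t : square) :
  inD lam t -> ~~ corner lam t -> ~ stopped lam t.
Proof.
case: t => i j ijD /negP nc st; apply: nc.
have [/negP nv _] := st (i + 1); have [_ /negP nh] := st (j + 1).
move: nv nh; rewrite /vmove /hmove ijD /= => nv nh.
by apply: corner_of_no_move => //; [move: nv|move: nh]; lia.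
Qed.

Lemma corner_stopped (r s : nat) : corner lam (r%:Z, s%:Z) ->
  stopped lam (r%:Z, s%:Z).
Proof.
move=> c k; have [rl s1 pr cs] := cornerP lam_part c.
have D : inD lam (r%:Z, s%:Z) by rewrite /inD /= pr; lia.
by rewrite /vmove /hmove D /= pr cs; lia.
Qed.

Section AtCorner.
Variables (r s : nat).
Hypothesis c : corner lam (r%:Z, s%:Z).

Lemma inD_quadrant (i j : int) : i <= r%:Z -> j <= s%:Z -> inD lam (i, j).
Proof.
move=> ir js; have [rl s1 pr cs] := cornerP lam_part c.
by have := @leq_part _ lam_part i r ir; rewrite /inD /= pr; lia.
Qed.

Lemma quadrant_not_corner (t : square) : t.1 <= r%:Z -> t.2 <= s%:Z ->
  t != (r%:Z, s%:Z) -> ~~ corner lam t.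
Proof.
case: t => i j /= ir js; apply: contra => c'.
have [i0 ei] : exists i0 : nat, i = i0%:Z.
  by exists `|i|%N; move: c'; rewrite /corner /diagram /=; lia.
have [j0 ej] : exists j0 : nat, j = j0%:Z.
  by exists `|j|%N; move: c'; rewrite /corner /diagram /=; lia.
subst i j; have [_ _ pr cs] := cornerP lam_part c.
have [_ _ pr' cs'] := cornerP lam_part c'.
have := @leq_part _ lam_part i0 r; have := @leq_cpart _ lam_part j0 s.
rewrite xpair_eqE; lia.
Qed.

(** Down and right moves increase a coordinate. An up move in a column j <= s ends at a row index
    above λ'_j >= λ'_s = r, and left moves are dual. *)
Lemma outside_quadrant_closed (t u : square) :
  ~~ ((t.1 <= r%:Z) && (t.2 <= s%:Z)) -> step lam x y t u != 0 ->
  ~~ ((u.1 <= r%:Z) && (u.2 <= s%:Z)).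
Proof.
have [_ _ pr cs] := cornerP lam_part c.
case: t u => [i j] [k m] nQ /step_neq0[[_ [-> ->]]//|[/= -> v]|[/= -> h]];
  apply/negP => /andP[kr ms]; move/negP: nQ; apply; rewrite ?kr ?ms ?andbT /=.
  have := @leq_cpart _ lam_part j s ms.
  by move: v; rewrite /vmove; case: ifP => _ /=; lia.
have := @leq_part _ lam_part i r kr.
by move: h; rewrite /hmove; case: ifP => _ /=; lia.
Qed.

(** This is [hit_rec] divided by the hook weight: transitions are supported on the disjoint column
    part C and row part L of the hook. *)
Lemma hit_harmonic (t : square) : t.1 <= r%:Z -> t.2 <= s%:Z ->
  t != (r%:Z, s%:Z) ->
  (\esum_(u in [set: square]) (step lam x y t u * hit lam x y r s u)%:E =
   (hit lam x y r s t)%:E)%E.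
Proof.
case: t => i j ir js tc.
have ijD := inD_quadrant ir js.
have nc := quadrant_not_corner ir js tc.
have nst : `[< stopped lam (i, j) >] = false by apply/asboolPn/not_stopped.
have tot0 := move_total_gt0 lam_part lam_neq0 x_gt0 y_gt0 ijD nc.
pose C := (fun k : int => (k, j)) @` [set k : int | i < k <= cpart lam j].
pose L := (fun k : int => (i, k)) @` [set k : int | j < k <= part lam i].
have finC : finite_set C by apply/finite_image/finite_int_itv.
have finL : finite_set L by apply/finite_image/finite_int_itv.
rewrite (@esum_support _ _ _ (C `|` L))//; last first.
  move=> u _ nCL; have [->|/step_neq0[[/asboolP]|[u2 v]|[u1 h]]] :=
      eqVneq (step lam x y (i, j) u) 0; first by rewrite mul0r.
  - by rewrite nst.
  - exfalso; apply: nCL; left; exists u.1; last first.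
      by rewrite [RHS]surjective_pairing u2.
    by move: v; rewrite /vmove ijD.
  - exfalso; apply: nCL; right; exists u.2; last first.
      by rewrite [RHS]surjective_pairing u1.
    by move: h; rewrite /hmove ijD.
rewrite esum_fset; first last.
- by move=> u _; rewrite lee_fin mulr_ge0 ?step_ge0 ?hit_ge0.
- by rewrite finite_setU.
rewrite fsumEFin ?finite_setU//; congr (_%:E).
rewrite fsbigU//; last first.
  by move=> u [[k /= ki <-] [m /= mj [mk]]]; move: ki; rewrite mk ltxx.
rewrite !fsbig_image/=; [|by move=> a b _ _ []|by move=> a b _ _ []].
apply: (mulfI (lt0r_neq0 tot0)); rewrite hit_rec// mulrDr; congr (_ + _).
- rewrite mulrC -isum_mulr; apply: eq_isum => k kij.
  rewrite /step nst eqxx /vmove ijD /= kij.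
  by rewrite mulrAC divfK ?gt_eqF.
- rewrite mulrC -isum_mulr; apply: eq_isum => k kij.
  (* [step] tests for a vertical move first; here k > j, so that test fails. *)
  rewrite /step nst /= [k == j]gt_eqF /=; last by case/andP: kij.
  rewrite eqxx /hmove ijD /= kij.
  by rewrite mulrAC divfK ?gt_eqF.
Qed.

Definition rank (t : square) : nat :=
  (`|(size lam)%:Z - t.1| + `|(part lam 1)%:Z - t.2|)%N.

Lemma rank_lt (t u : square) : inD lam t -> ~~ corner lam t ->
  step lam x y t u != 0 -> (rank u < rank t)%N.
Proof.
case: t u => i j [k m] ijD nc /step_neq0[[st _]|[/= -> v]|[/= -> h]].
- by case: (not_stopped ijD nc).
- have := cpart_leq lam j; move: v; rewrite /vmove ijD /rank/=; lia.
- have : (part lam i <= part lam 1)%N.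
    by case: (leP i 0) => k0; [rewrite part_le0// part0|rewrite leq_part].
  move: h; rewrite /hmove ijD /rank/=; lia.
Qed.

Section Law.
Context d (T : measurableType d) (P : probability T R) (S : nat -> T -> square).
Hypothesis walk : is_hook_walk lam x y P S.

(** The starting set is arbitrary: the complement of the quadrant up to c serves as the closed set
    Z, and it contains R_5 to R_10, so these need no separate analysis. *)
Lemma P_terminates (A : set square) :
  (P (terminates_in lam S (r%:Z, s%:Z) `&` S 0%N @^-1` A) =
   \esum_(t in A) (start x y t * hit lam x y r s t)%:E)%E.
Proof.
case: walk => mS P0 PS.
(* A corner is a stopping square, so terminating there means visiting it. *)
have -> : terminates_in lam S (r%:Z, s%:Z) = reach S 0 (r%:Z, s%:Z).
  apply/seteqP; split => w; first by move=> [_ [n wn]]; exists n.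
  by move=> [n [_ wn]]; split; [exact: corner_stopped|exists n].
rewrite (measure_fibers P (mS 0%N)); last exact: measurable_reach.
apply: eq_esum => t _.
have -> : reach S 0 (r%:Z, s%:Z) `&` S 0%N @^-1` [set t] =
    path_prefix S 0 (fun=> t) `&` reach S 0 (r%:Z, s%:Z).
  rewrite setIC; congr (_ `&` _); apply/seteqP; split => w /=.
    by move=> wt k; rewrite leqn0 => /eqP ->.
  by move=> /(_ 0%N); exact.
have pre0 : P (path_prefix S 0 (fun=> t)) = (start x y t)%:E.
  rewrite -P0; congr (P _); apply/seteqP; split => w /=.
    by move=> /(_ 0%N); exact.
  by move=> wt k; rewrite leqn0 => /eqP ->.
rewrite EFinM -pre0; apply: (@P_reach _ _ _ _ _ _ (step lam x y) mS PS _
  [set t | ~~ ((t.1 <= r%:Z) && (t.2 <= s%:Z))] _ _ (hit lam x y r s) rank).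
- exact: outside_quadrant_closed.
- by rewrite /= !lexx.
- exact: step_ge0.
- exact: hit_ge0.
- by move=> u /=; exact: hit_gt.
- exact: hit_self.
- by move=> u /= /negP; rewrite negbK => /andP[ur us]; exact: hit_harmonic.
- move=> u v /= /negP; rewrite negbK => /andP[ur us] uc.
  apply: rank_lt; last exact: quadrant_not_corner.
  by rewrite [u]surjective_pairing; exact: inD_quadrant.
Qed.

Lemma P_start (A : set square) :
  (P (S 0%N @^-1` A) = \esum_(t in A) (start x y t)%:E)%E.
Proof.
case: walk => mS P0 _.
rewrite -[X in P X]setTI (measure_fibers P (mS 0%N)) ?measurableT//.
by apply: eq_esum => t _; rewrite setTI; exact: P0.
Qed.

End Law.
End AtCorner.
End Walk.

(** * Conditional probabilities and corner sums *)

Lemma esum_isum (R : realType) (z : int -> R) (a b : int) :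
  (forall i, 0 <= z i) ->
  (\esum_(i in [set i | (a < i <= b)%R]) (z i)%:E = (isum z a b)%:E)%E.
Proof.
move=> z0; rewrite esum_fset ?fsumEFin//; try exact: finite_int_itv.
by move=> i _; rewrite lee_fin.
Qed.

(** A finite total makes every partial sum finite, so the [fine] inside [zsum] loses nothing. *)
Lemma esum_zsum (R : realType) (z : int -> R) (A : set int) :
  (forall i, 0 <= z i) -> (\esum_(i in [set: int]) (z i)%:E < +oo)%E ->
  (\esum_(i in A) (z i)%:E = (zsum z A)%:E)%E.
Proof.
move=> z0 zoo; rewrite fineK// ge0_fin_numE; last first.
  by apply: esum_ge0 => i _; rewrite lee_fin.
apply: le_lt_trans zoo; rewrite esum_mkcond; apply: le_esum => i _.
by case: ifP => // _; rewrite lee_fin.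
Qed.

Lemma zsum_gt0 (R : realType) (z : int -> R) (A : set int) : A 0 ->
  (forall i, 0 < z i) -> (\esum_(i in [set: int]) (z i)%:E < +oo)%E ->
  0 < zsum z A.
Proof.
move=> A0 z0 zoo; have z0' i : 0 <= z i by rewrite ltW.
rewrite -lte_fin -esum_zsum//; apply: (@lt_le_trans _ _ (z 0)%:E).
  by rewrite lte_fin.
rewrite -(@esum_set1 _ _ 0 (fun i => (z i)%:E)) ?lee_fin//.
rewrite esum_mkcond [leRHS]esum_mkcond; apply: le_esum => i _.
case: ifPn => [/set_mem ->|_]; first by rewrite mem_set.
by case: ifP => // _; rewrite lee_fin.
Qed.

(** Summing over j first leaves the constant v, which is then pulled out of the sum over i. *)
Lemma esum_setX (R : realType) (a b : int -> R) (A B : set int) (u v : R) :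
  (forall i, 0 <= a i) -> (forall j, 0 <= b j) ->
  (\esum_(i in A) (a i)%:E = u%:E)%E -> (\esum_(j in B) (b j)%:E = v%:E)%E ->
  (\esum_(t in A `*` B) (a t.1 * b t.2)%:E = (u * v)%:E)%E.
Proof.
move=> a0 b0 Au Bv; have v0 : 0 <= v.
  by rewrite -lee_fin -Bv; apply: esum_ge0 => j _; rewrite lee_fin.
rewrite -(@esum_esum _ _ _ A (fun=> B) (fun i j => (a i * b j)%:E)); last first.
  by move=> i j _ _; rewrite lee_fin mulr_ge0.
under eq_esum => i _.
  under eq_esum do rewrite EFinM.
  rewrite ge0_esumZl//; last by move=> j _; rewrite lee_fin.
  rewrite Bv muleC; over.
rewrite ge0_esumZl//; last by move=> j _; rewrite lee_fin.
by rewrite Au -EFinM mulrC.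
Qed.

(** * Region sums of h, the four formulas and their corner sums *)

Section Weights.
Variables (R : realType) (lam : seq nat) (x y : int -> R).
Hypotheses (lam_part : is_partition lam) (lam_neq0 : lam <> [::]).
Hypotheses (x_gt0 : forall i, 0 < x i) (y_gt0 : forall j, 0 < y j).
Local Notation l := (size lam).

(** R_1 is not a rectangle, so it is fibred over its rows. *)
Lemma esum_region1 (a : int -> int -> R) : (forall i j, 0 <= a i j) ->
  (\esum_(t in region1 lam) (a t.1 t.2)%:E =
   (isum (fun i => isum (a i) 0 (part lam i)) 0 l)%:E)%E.
Proof.
move=> a0; rewrite (_ : region1 lam = [set i : int | 0 < i <= l%:Z] `*``
    (fun i => [set j : int | 0 < j <= (part lam i)%:Z])); last first.
  by apply/seteqP; split => -[i j] /=; rewrite /region1/= /diagram/=; lia.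
rewrite -(@esum_esum _ _ _ _ _ (fun i j => (a i j)%:E))/=; last first.
  by move=> i j _ _; rewrite lee_fin.
under eq_esum do rewrite esum_isum//.
by rewrite esum_isum// => i; apply: fsumr_ge0.
Qed.

Section AtCorner.
Variables (r s : nat).
Hypothesis c : corner lam (r%:Z, s%:Z).

Let row_r : row_tail lam y s r = 0.
Proof.
by have [_ _ pr _] := cornerP lam_part c; rewrite /row_tail pr isum_geq.
Qed.

Let col_s : col_tail lam x r s = 0.
Proof.
by have [_ _ _ cs] := cornerP lam_part c; rewrite /col_tail cs isum_geq.
Qed.

(** This is F_1, and [col_sum] is G_1. *)
Definition row_sum : R := isum (fun i => x i * row_factor lam x y r s i) 0 r.
Definition col_sum : R := isum (fun j => y j * col_factor lam x y r s j) 0 s.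

Lemma hook_PiE : hook_Pi lam x y r s = row_sum * col_sum.
Proof.
have [rl s1 _ _] := cornerP lam_part c.
rewrite /row_sum /col_sum !isum_factor_prod//; last by case/andP: rl.
rewrite /hook_Pi mulrACA -!mulrA; congr (_ * (_ * (_ * _))).
  apply: eq_bigr => i _; rewrite !isum_nat.
  by rewrite /arm /row_tail.
apply: eq_bigr => j _; rewrite !isum_nat.
by rewrite /arm /col_tail [isum y j s + _]addrC.
Qed.

(** This is A_0, since λ_0 = λ_1 in the extension; dually [hook_low] is B_0, since λ'_0 = l. *)
Lemma hook_highE : hook_high lam x y r s = arm x (row_tail lam y s) r 0.
Proof. by rewrite /hook_high !isum_nat /arm /row_tail part0. Qed.

Lemma hook_lowE : hook_low lam x y r s = arm y (col_tail lam x r) s 0.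
Proof.
by rewrite /hook_low !isum_nat /arm /col_tail addrC cpart_le0.
Qed.

Lemma hook_high_gt0 : 0 < hook_high lam x y r s.
Proof.
have [rl s1 _ _] := cornerP lam_part c.
by rewrite hook_highE arm_gt0//; [exact: row_tail_ge0|lia].
Qed.

Lemma hook_low_gt0 : 0 < hook_low lam x y r s.
Proof.
have [rl s1 _ _] := cornerP lam_part c.
by rewrite hook_lowE arm_gt0//; exact: col_tail_ge0.
Qed.

Lemma row_factor_le0 (i : int) : i <= 0 ->
  row_factor lam x y r s i = row_sum / hook_high lam x y r s.
Proof.
have [rl s1 _ _] := cornerP lam_part c.
move=> i0; rewrite hook_highE /row_factor hook_factor_le0//.
- exact: row_tail_ge0.
- lia.
- by move=> k k0; rewrite /row_tail part_le0.
Qed.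

Lemma col_factor_le0 (j : int) : j <= 0 ->
  col_factor lam x y r s j = col_sum / hook_low lam x y r s.
Proof.
have [rl s1 _ _] := cornerP lam_part c.
move=> j0; rewrite hook_lowE /col_factor hook_factor_le0//.
- exact: col_tail_ge0.
- by move=> k k0; rewrite /col_tail !cpart_le0.
Qed.

Lemma isum_row : isum (fun i => x i * row_factor lam x y r s i) 0 l = row_sum.
Proof.
have [rl s1 _ _] := cornerP lam_part c.
by rewrite isum_factor_cap//; lia.
Qed.

Lemma isum_col (n : nat) : (s <= n)%N ->
  isum (fun j => y j * col_factor lam x y r s j) 0 n = col_sum.
Proof. by move=> sn; rewrite isum_factor_cap//; lia. Qed.

(** The sum factors although R_1 is no rectangle: for i <= r the row reaches column s, as λ_i >= λ_r
    = s, so its inner sum is f(i) G_1, and for i > r the factor f(i) is 0. *)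
Lemma isum_hit_region1 :
  isum (fun i => x i *
    isum (fun j => y j * hit lam x y r s (i, j)) 0 (part lam i)) 0 l =
  hook_Pi lam x y r s.
Proof.
rewrite hook_PiE -isum_row -isum_mulr; apply: eq_isum => i _.
rewrite -mulrA; congr (_ * _).
transitivity (row_factor lam x y r s i *
    isum (fun j => y j * col_factor lam x y r s j) 0 (part lam i)).
  by rewrite -isum_mull; apply: eq_isum => j _; rewrite mulrCA.
have [_ _ pr _] := cornerP lam_part c.
case: (leP i r%:Z) => ir; first by rewrite isum_col// -pr leq_part.
by rewrite [row_factor _ _ _ _ _ _]hook_factor_gt// !mul0r.
Qed.

(** On R_2 the value of h does not depend on j <= 0, so (b) is an average of h over rows 1 to l of
    column 0, the form that [corner_sum_average] takes. *)
Lemma formula2E : formula2 lam x y r s =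
  isum (fun i => x i * hit lam x y r s (i, 0)) 0 l / isum x 0 l.
Proof.
rewrite /formula2 isum_nat hook_PiE -isum_row.
rewrite [X in X / isum x 0 l](_ : _ =
  isum (fun i => x i * row_factor lam x y r s i) 0 l *
  (col_sum / hook_low lam x y r s)).
  by rewrite invfM; ring.
rewrite -isum_mulr; apply: eq_isum => i _.
by rewrite /hit/= col_factor_le0// mulrA.
Qed.

Lemma formula3E : formula3 lam x y r s =
  isum (fun j => y j * hit lam x y r s (0, j)) 0 (part lam 1) /
  isum y 0 (part lam 1).
Proof.
have [rl s1 pr _] := cornerP lam_part c.
have sp : (s <= part lam 1)%N by rewrite -pr leq_part//; lia.
rewrite /formula3 isum_nat hook_PiE -(isum_col sp).
rewrite [X in X / isum y 0 _](_ : _ =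
  isum (fun j => y j * col_factor lam x y r s j) 0 (part lam 1) *
  (row_sum / hook_high lam x y r s)).
  by rewrite invfM; ring.
rewrite -isum_mulr; apply: eq_isum => j _.
by rewrite /hit/= row_factor_le0//; ring.
Qed.

Lemma formula4E : formula4 lam x y r s = hit lam x y r s (0, 0).
Proof.
rewrite /hit/= row_factor_le0// col_factor_le0//.
by rewrite /formula4 hook_PiE invfM; ring.
Qed.

End AtCorner.

Lemma sum_region1E :
  \sum_(1 <= p < l.+1) \sum_(1 <= q < (part lam p).+1) x p * y q =
  isum (fun i => x i * isum y 0 (part lam i)) 0 l.
Proof.
rewrite -isum_nat; apply: eq_bigr => i _.
by rewrite (isum_nat (fun j => x i * y j)) isum_mull.
Qed.

Let l_gt0 : (0 < l)%N.
Proof. by case: (lam) lam_neq0. Qed.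

Let p_gt0 (i : int) : i <= l%:Z -> (0 < part lam i)%N.
Proof. exact: part_row_gt0. Qed.

Lemma isum_region1_gt0 : 0 < isum (fun i => x i * isum y 0 (part lam i)) 0 l.
Proof.
rewrite isum_recl; last lia.
rewrite ltr_wpDr ?mulr_gt0 ?isum_gt0//.
  by apply: fsumr_ge0 => i _; rewrite mulr_ge0 ?isum_ge0// ltW.
by apply: p_gt0; rewrite add0r.
Qed.

(** Exchanging the two sums leaves [corner_sum_hit] at each square, averaged with the weights z. *)
Lemma corner_sum_average (z : int -> R) (t : int -> square) (a b : int) :
  (forall i, 0 < z i) -> a < b -> (forall k, a < k <= b -> inD lam (t k)) ->
  corner_sum lam (fun r s =>
    isum (fun k => z k * hit lam x y r s (t k)) a b / isum z a b) = 1.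
Proof.
move=> z0 ab tD.
rewrite (eq_corner_sum (G := fun r s => (isum z a b)^-1 *
  isum (fun k => z k * hit lam x y r s (t k)) a b)); last first.
  by move=> r s _; rewrite mulrC.
rewrite corner_sumM corner_sum_isum.
rewrite (eq_isum (w := z)) ?mulVf ?gt_eqF ?isum_gt0// => k kab.
by rewrite corner_sum_hit ?mulr1//; exact: tD.
Qed.

Lemma sum_formula1 : corner_sum lam (formula1 lam x y) = 1.
Proof.
have D0 := isum_region1_gt0.
rewrite (eq_corner_sum (G := fun r s =>
  (isum (fun i => x i * isum y 0 (part lam i)) 0 l)^-1 *
  isum (fun i => x i *
    isum (fun j => y j * hit lam x y r s (i, j)) 0 (part lam i)) 0 l));
  last first.
  by move=> r s c; rewrite isum_hit_region1// mulrC /formula1 sum_region1E.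
rewrite corner_sumM.
rewrite (corner_sum_isum _ _ (fun i r s =>
  isum (fun j => y j * hit lam x y r s (i, j)) 0 (part lam i))).
rewrite (eq_isum (w := fun i => x i * isum y 0 (part lam i))).
  by rewrite mulVf// gt_eqF.
move=> i /andP[i0 il]; rewrite corner_sum_isum; congr (_ * _).
apply: eq_isum => j /andP[j0 jp]; rewrite corner_sum_hit ?mulr1//.
by rewrite /inD/= il jp.
Qed.

Lemma sum_formula2 : corner_sum lam (formula2 lam x y) = 1.
Proof.
rewrite (eq_corner_sum (fun r s c => formula2E c)).
apply: corner_sum_average => //.
by move=> k /andP[_ kl]; rewrite /inD/= kl; lia.
Qed.

Lemma sum_formula3 : corner_sum lam (formula3 lam x y) = 1.
Proof.
rewrite (eq_corner_sum (fun r s c => formula3E c)).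
apply: corner_sum_average => //; first by have := @p_gt0 1; lia.
by move=> k /andP[_ kp]; rewrite /inD/= part0 kp; lia.
Qed.

Lemma sum_formula4 : corner_sum lam (formula4 lam x y) = 1.
Proof.
by rewrite (eq_corner_sum (fun r s c => formula4E c)) corner_sum_hit.
Qed.

(** * Probabilities for the walk with summable weights *)

Section Law.
Hypothesis x_sum : (\esum_(i in [set: int]) (x i)%:E < +oo)%E.
Hypothesis y_sum : (\esum_(j in [set: int]) (y j)%:E < +oo)%E.
Context d (T : measurableType d) (P : probability T R) (S : nat -> T -> square).
Hypothesis walk : is_hook_walk lam x y P S.

Let x_ge0 i : 0 <= x i. Proof. exact: ltW. Qed.
Let y_ge0 j : 0 <= y j. Proof. exact: ltW. Qed.

Local Notation mass := (zsum x [set: int] * zsum y [set: int]).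

Let mass_gt0 : 0 < mass.
Proof. by rewrite mulr_gt0 ?zsum_gt0. Qed.

Lemma P_start_weight (A : set square) (v : R) :
  (\esum_(t in A) (x t.1 * y t.2)%:E = v%:E)%E ->
  P (S 0%N @^-1` A) = (mass^-1 * v)%:E.
Proof.
move=> Av; rewrite (P_start walk) EFinM -Av -ge0_esumZl.
- by apply: eq_esum => t _; rewrite -EFinM /start mulrC.
- by rewrite invr_ge0 ltW.
- by move=> t _; rewrite lee_fin mulr_ge0.
Qed.

Section AtCorner.
Variables (r s : nat).
Hypothesis c : corner lam (r%:Z, s%:Z).

Definition row_weight (i : int) : R := x i * row_factor lam x y r s i.
Definition col_weight (j : int) : R := y j * col_factor lam x y r s j.

Lemma row_weight_ge0 (i : int) : 0 <= row_weight i.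
Proof. by rewrite mulr_ge0 ?row_factor_ge0. Qed.

Lemma col_weight_ge0 (j : int) : 0 <= col_weight j.
Proof. by rewrite mulr_ge0 ?col_factor_ge0. Qed.

Lemma P_terminates_weight (A : set square) (u : R) :
  (\esum_(t in A) (x t.1 * y t.2 * hit lam x y r s t)%:E = u%:E)%E ->
  P (terminates_in lam S (r%:Z, s%:Z) `&` S 0%N @^-1` A) = (mass^-1 * u)%:E.
Proof.
move=> Au; rewrite (P_terminates lam_part lam_neq0 x_gt0 y_gt0 c walk).
rewrite EFinM -Au -ge0_esumZl.
- by apply: eq_esum => t _; rewrite -EFinM /start; congr (_%:E); ring.
- by rewrite invr_ge0 ltW.
- by move=> t _; rewrite lee_fin mulr_ge0 ?hit_ge0// mulr_ge0.
Qed.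

(** The starting law divides all weights by the same total mass, which cancels in the quotient. *)
Lemma cond_prob_ratio (A : set square) (u v : R) :
  (\esum_(t in A) (x t.1 * y t.2 * hit lam x y r s t)%:E = u%:E)%E ->
  (\esum_(t in A) (x t.1 * y t.2)%:E = v%:E)%E ->
  cond_prob P (terminates_in lam S (r%:Z, s%:Z)) (S 0%N @^-1` A) = u / v.
Proof.
move=> /P_terminates_weight Au /P_start_weight Av.
rewrite /cond_prob Au Av /= -mulf_div divff ?mul1r//.
by rewrite invr_eq0 gt_eqF.
Qed.

(** The starting weights and h are both products of a row part and a column part, so the sum over a
    rectangle factors. *)
Lemma esum_hit_setX (A B : set int) (u v : R) :
  (\esum_(i in A) (row_weight i)%:E = u%:E)%E ->
  (\esum_(j in B) (col_weight j)%:E = v%:E)%E ->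
  (\esum_(t in A `*` B) (x t.1 * y t.2 * hit lam x y r s t)%:E = (u * v)%:E)%E.
Proof.
move=> Au Bv; rewrite -(esum_setX row_weight_ge0 col_weight_ge0 Au Bv).
by apply: eq_esum => t _; rewrite /hit mulrACA.
Qed.

Local Notation nonpos := [set i : int | i <= 0].

Lemma esum_row_le0 : (\esum_(i in nonpos) (row_weight i)%:E =
  (zsum x nonpos * (row_sum r s / hook_high lam x y r s))%:E)%E.
Proof.
rewrite mulrC EFinM -esum_zsum// -ge0_esumZl.
- apply: eq_esum => i /= i0.
  by rewrite -EFinM /row_weight row_factor_le0// mulrC.
- rewrite divr_ge0 ?(ltW (hook_high_gt0 _))//.
  by apply: fsumr_ge0 => i _; exact: row_weight_ge0.
- by move=> i _; rewrite lee_fin.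
Qed.

Lemma esum_col_le0 : (\esum_(j in nonpos) (col_weight j)%:E =
  (zsum y nonpos * (col_sum r s / hook_low lam x y r s))%:E)%E.
Proof.
rewrite mulrC EFinM -esum_zsum// -ge0_esumZl.
- apply: eq_esum => j /= j0.
  by rewrite -EFinM /col_weight col_factor_le0// mulrC.
- rewrite divr_ge0 ?(ltW (hook_low_gt0 _))//.
  by apply: fsumr_ge0 => j _; exact: col_weight_ge0.
- by move=> j _; rewrite lee_fin.
Qed.

(** Indices beyond n contribute nothing, which leaves the nonpositive ones and 1 to n. *)
Lemma esum_int_split (z : int -> R) (n : nat) (u : R) :
  (forall i, 0 <= z i) -> (forall i : int, n%:Z < i -> z i = 0) ->
  (\esum_(i in nonpos) (z i)%:E = u%:E)%E ->
  (\esum_(i in [set: int]) (z i)%:E = (u + isum z 0 n)%:E)%E.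
Proof.
move=> z0 zn zu; rewrite (esumID nonpos); last by move=> i _; rewrite lee_fin.
rewrite !setTI zu EFinD -esum_isum//; congr (_ + _)%E.
apply: esum_support => i /=; rewrite /nonpos/=; first lia.
by move=> /negP i0 /negP ni; rewrite zn//; lia.
Qed.

Let row_pos : (\esum_(i in [set i : int | (0 < i <= l%:Z)%R])
  (row_weight i)%:E = (row_sum r s)%:E)%E.
Proof.
by rewrite esum_isum; [rewrite isum_row|exact: row_weight_ge0].
Qed.

Let col_pos : (\esum_(j in [set j : int | (0 < j <= (part lam 1)%:Z)%R])
  (col_weight j)%:E = (col_sum r s)%:E)%E.
Proof.
have [rl _ pr _] := cornerP lam_part c.
rewrite esum_isum; last exact: col_weight_ge0.
by rewrite isum_col// -pr leq_part//; lia.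
Qed.

Let x_nonpos_gt0 : 0 < zsum x nonpos.
Proof. by rewrite zsum_gt0/=. Qed.

Let y_nonpos_gt0 : 0 < zsum y nonpos.
Proof. by rewrite zsum_gt0/=. Qed.

Let region2X : region2 lam = [set i : int | 0 < i <= l%:Z] `*` nonpos.
Proof. by apply/seteqP; split => -[i j] /=; rewrite /region2/=; lia. Qed.

Let region3X :
  region3 lam = nonpos `*` [set j : int | 0 < j <= (part lam 1)%:Z].
Proof. by apply/seteqP; split => -[i j] /=; rewrite /region3/=; lia. Qed.

Let region4X : region4 = nonpos `*` nonpos.
Proof. by apply/seteqP; split => -[i j] /=; rewrite /region4/=; lia. Qed.

Lemma cond_prob_region1 :
  cond_prob P (terminates_in lam S (r%:Z, s%:Z)) (S 0%N @^-1` region1 lam) =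
  formula1 lam x y r s.
Proof.
rewrite /formula1 sum_region1E -(isum_hit_region1 c).
apply: cond_prob_ratio.
  rewrite (esum_region1 (a := fun i j => x i * y j * hit lam x y r s (i, j))).
    congr (_%:E); apply: eq_isum => i _; rewrite -isum_mull.
    by apply: eq_isum => j _; rewrite mulrA.
  by move=> i j; rewrite mulr_ge0 ?hit_ge0 // mulr_ge0.
rewrite (esum_region1 (a := fun i j => x i * y j)).
  by congr (_%:E); apply: eq_isum => i _; rewrite isum_mull.
by move=> i j; rewrite mulr_ge0.
Qed.

(** R_2 is a rectangle and g is constant on j <= 0, so the total of y_j over j <= 0 appears in
    numerator and denominator and cancels. R_3 and R_4 are treated the same way. *)
Lemma cond_prob_region2 :
  cond_prob P (terminates_in lam S (r%:Z, s%:Z)) (S 0%N @^-1` region2 lam) =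
  formula2 lam x y r s.
Proof.
have low0 := hook_low_gt0 c; have x0 : 0 < isum x 0 l by exact: isum_gt0.
rewrite region2X (cond_prob_ratio (esum_hit_setX row_pos esum_col_le0)
  (esum_setX x_ge0 y_ge0 (esum_isum _ _ x_ge0) (esum_zsum _ y_ge0 y_sum))).
rewrite /formula2 isum_nat (hook_PiE c).
by field; rewrite !gt_eqF.
Qed.

Lemma cond_prob_region3 :
  cond_prob P (terminates_in lam S (r%:Z, s%:Z)) (S 0%N @^-1` region3 lam) =
  formula3 lam x y r s.
Proof.
have high0 := hook_high_gt0 c.
have y0 : 0 < isum y 0 (part lam 1) by apply: isum_gt0 => //; exact: p_gt0.
rewrite region3X (cond_prob_ratio (esum_hit_setX esum_row_le0 col_pos)
  (esum_setX x_ge0 y_ge0 (esum_zsum _ x_ge0 x_sum) (esum_isum _ _ y_ge0))).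
rewrite /formula3 isum_nat (hook_PiE c).
by field; rewrite !gt_eqF.
Qed.

Lemma cond_prob_region4 :
  cond_prob P (terminates_in lam S (r%:Z, s%:Z)) (S 0%N @^-1` region4) =
  formula4 lam x y r s.
Proof.
have low0 := hook_low_gt0 c; have high0 := hook_high_gt0 c.
rewrite region4X (cond_prob_ratio (esum_hit_setX esum_row_le0 esum_col_le0)
  (esum_setX x_ge0 y_ge0 (esum_zsum _ x_ge0 x_sum) (esum_zsum _ y_ge0 y_sum))).
rewrite /formula4 (hook_PiE c).
by field; rewrite !gt_eqF.
Qed.

(** The whole plane is a rectangle on which h vanishes for i > r or j > s. The row sum is F_1 times
    1 plus the x-mass of i <= 0 over A_0, the column sum is dual, and F_1 G_1 is the product
    Pi_{rs}. *)
Lemma P_terminates_corner :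
  P (terminates_in lam S (r%:Z, s%:Z)) =
    ((zsum x [set: int] * zsum y [set: int])^-1 *
     (1 + zsum x [set p | p <= 0] / hook_high lam x y r s) *
     (1 + zsum y [set q | q <= 0] / hook_low lam x y r s) *
     hook_Pi lam x y r s)%:E.
Proof.
have rowT : (\esum_(i in [set: int]) (row_weight i)%:E = (zsum x nonpos *
    (row_sum r s / hook_high lam x y r s) + row_sum r s)%:E)%E.
  apply: (esum_int_split row_weight_ge0 _ esum_row_le0) => i ri.
  by rewrite /row_weight [row_factor _ _ _ _ _ _]hook_factor_gt// mulr0.
have colT : (\esum_(j in [set: int]) (col_weight j)%:E = (zsum y nonpos *
    (col_sum r s / hook_low lam x y r s) + col_sum r s)%:E)%E.
  apply: (esum_int_split col_weight_ge0 _ esum_col_le0) => j sj.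
  by rewrite /col_weight [col_factor _ _ _ _ _ _]hook_factor_gt// mulr0.
rewrite -[terminates_in _ _ _]setIT -(preimage_setT (S 0%N)) -setXTT.
rewrite (P_terminates_weight (esum_hit_setX rowT colT)); congr (_%:E).
by rewrite (hook_PiE c); ring.
Qed.

End AtCorner.
End Law.
End Weights.

Theorem theorem3 (R : realType) (lam : seq nat) (x y : int -> R)
    (lam_part : is_partition lam) (lam_neq0 : lam <> [::])
    (x_gt0 : forall i, 0 < x i) (y_gt0 : forall j, 0 < y j)
    (x_sum : (\esum_(i in [set: int]) (x i)%:E < +oo)%E)
    (y_sum : (\esum_(j in [set: int]) (y j)%:E < +oo)%E) :
  (forall (d : measure_display) (T : measurableType d) (P : probability T R)
      (S : nat -> T -> square),
    is_hook_walk lam x y P S ->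
    forall r s : nat, corner lam (r%:Z, s%:Z) ->
    let c := (r%:Z, s%:Z) in
    [/\ cond_prob P (terminates_in lam S c) (S 0%N @^-1` region1 lam) =
          formula1 lam x y r s,
        cond_prob P (terminates_in lam S c) (S 0%N @^-1` region2 lam) =
          formula2 lam x y r s,
        cond_prob P (terminates_in lam S c) (S 0%N @^-1` region3 lam) =
          formula3 lam x y r s,
        cond_prob P (terminates_in lam S c) (S 0%N @^-1` region4) =
          formula4 lam x y r s
      & P (terminates_in lam S c) =
          ((zsum x [set: int] * zsum y [set: int])^-1 *
           (1 + zsum x [set p | p <= 0] / hook_high lam x y r s) *
           (1 + zsum y [set q | q <= 0] / hook_low lam x y r s) *
           hook_Pi lam x y r s)%:E]) /\
  [/\ corner_sum lam (formula1 lam x y) = 1,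
      corner_sum lam (formula2 lam x y) = 1,
      corner_sum lam (formula3 lam x y) = 1
    & corner_sum lam (formula4 lam x y) = 1].
Proof.
split; last by split; [exact: sum_formula1|exact: sum_formula2|
  exact: sum_formula3|exact: sum_formula4].
move=> d T P S walk r s c /=; split.
- exact: cond_prob_region1.
- exact: cond_prob_region2.
- exact: cond_prob_region3.
- exact: cond_prob_region4.
- exact: P_terminates_corner.
Qed.
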